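(* Let $m\ge2$ be an integer, let $R$ be an integral domain in which $m!\ne0$, and let $\delta\in R$. Let $\widetilde{\mathcal{B}}(\delta)$ be the enhanced Brauer category over $R$ associated with $\delta$ and $m$, and assume that $\Sigma_m\ne0$ in $\widetilde{\mathcal{B}}(\delta)$. Then: (1) In the category $\widetilde{\mathcal{B}}(\delta)$ we have the equality of morphisms $\Sigma_{m+1}=f_m(\delta)\,\Sigma_m\otimes I$, where $m$ is the positive integer occurring in the definition of $\widetilde{\mathcal{B}}(\delta)$ and $f_m$ is the polynomial in $\delta$ given by $f_m(\delta)=(\delta-(m-1))(\delta-(m-2))\cdots(\delta-1)-(m-1)!$. (2) $\Sigma_{m+1}=0$. (3) $\delta=m$.
   Context: The enhanced Brauer category $\widetilde{\mathcal{B}}(\delta)$ (for a commutative ring $R$, $\delta\in R$ and a fixed integer $m\ge2$) is the $R$-linear tensor category with object set $\mathbb{N}=\{0,1,2,\dots\}$ (tensor product of objects being addition), with an involution $^*$ which fixes objects and reflects morphisms, viewed as diagrams, in a horizontal line (so it reverses the direction of morphisms), and with morphisms generated under composition, tensor product and the duality $^*$ by $I=\mathrm{id}_1:1\to1$, $U:0\to2$, $A=U^*:2\to0$, $X:2\to2$ and one further generator $\Delta_m:0\to m$, subject to the following relations. (1) The relations of the usual Brauer category with parameter $\delta$: $X\circ X=I\otimes I$; $(X\otimes I)(I\otimes X)(X\otimes I)=(I\otimes X)(X\otimes I)(I\otimes X)$; $A\circ X=A$; $X\circ U=U$; $A\circ U=\delta$; $(A\otimes I)(I\otimes X)=(I\otimes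 A)(X\otimes I)$; $(I\otimes X)(U\otimes I)=(X\otimes I)(I\otimes U)$; $(A\otimes I)(I\otimes U)=I=(I\otimes A)(U\otimes I)$. (2) (Harmonicity) For each integer $r$ with $0\le r\le m-2$, $(I^{\otimes r}\otimes A\otimes I^{\otimes(m-r-2)})\circ\Delta_m=0$. (3) For each integer $r$ with $0\le r\le m-2$, $(I^{\otimes r}\otimes X\otimes I^{\otimes(m-r-2)})\circ\Delta_m=-\Delta_m$. (4) $\Delta_m\circ\Delta_m^*=\Sigma_m$. Here $\Delta_m^*:m\to0$ is the reflection of $\Delta_m$, and $\Sigma_r=\sum_{\pi\in\mathrm{Sym}_r}\varepsilon(\pi)\pi:r\to r$ is the total antisymmetriser ($\varepsilon$ the sign character), where the simple transposition $s_i$ is identified with $I^{\otimes(i-1)}\otimes X\otimes I^{\otimes(r-i-1)}$.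
   Formalization: Added hypothesis: the R-modules Hom(m,m) and Hom(m+1,m+1) of the enhanced Brauer category are torsion-free (automatic over a field). Without it (3) fails, e.g. R = Z, m = 2, δ = 5, where Σ_2 is nonzero via a functor to vector spaces over F_3. *)

(* Defs.v *)
From HB Require Import structures.
From mathcomp Require Import all_boot all_order all_algebra all_fingroup.
From mathcomp Require Import generic_quotient boolp zify.

Set Implicit Arguments.
Unset Strict Implicit.
Unset Printing Implicit Defensive.

Import GRing.Theory.
Local Open Scope ring_scope.
Local Open Scope quotient_scope.

(* The enhanced Brauer category is presented by generators and relations.
   [term R m r s] is the type of formal expressions for morphisms r -> s,
   [term_eq delta] is the least R-linear strict monoidal congruence compatible
   with the involution [Star] that contains the defining relations, and the
   morphisms r -> s of the category are the classes, [hom delta m r s].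
   [Comp f g] is f o g ("f after g"). *)
Inductive term (R : Type) (m : nat) : nat -> nat -> Type :=
| Id r : term R m r r
| Cup : term R m 0 2
| Cap : term R m 2 0
| Cross : term R m 2 2
| Delta : term R m 0 m
| Comp r s t of term R m s t & term R m r s : term R m r t
| Tens r s r' s' of term R m r s & term R m r' s' :
    term R m (r + r') (s + s')
| Star r s of term R m r s : term R m s r
| Zero r s : term R m r s
| Add r s of term R m r s & term R m r s : term R m r s
| Scale r s of R & term R m r s : term R m r s.

Arguments Id {R m} r.
Arguments Cup {R m}.
Arguments Cap {R m}.
Arguments Cross {R m}.
Arguments Delta {R m}.
Arguments Zero {R m} r s.

Section Terms.
Variables (R : pzRingType) (m : nat).
Notation term := (term R m).

Definition cast_term r r' s s' (er : r = r') (es : s = s') (f : term r s) :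
  term r' s' := ecast k (term k s') er (ecast k (term r k) es f).

Definition pad i j r s (f : term r s) : term (i + r + j) (i + s + j) :=
  Tens (Tens (Id i) f) (Id j).

(* The crossing of the strands i and i.+1, counted from 0.  The default [Id r]
   is only reached when i.+1 < r fails. *)
Definition simple_cross r i : term r r :=
  if @eqP _ (i + 2 + (r - (i + 2)))%N r is ReflectT e
  then cast_term e e (pad i (r - (i + 2)) Cross) else Id r.

(* The product of a word in the simple transpositions; the head of the word is
   the transposition that is applied first. *)
Definition word_term r (w : seq nat) : term r r :=
  foldl (fun f i => Comp (simple_cross r i) f) (Id r) w.

(* A word for p read off from insertion sort: the strand k moves left past the
   c strands i < k with p k < p i.  This is indeed a word for p, see
   [perm_wordP]; the choice of the word is immaterial since Cross satisfies
   the Coxeter relations. *)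
Definition perm_word r (p : 'S_r) : seq nat :=
  flatten [seq let c := #|[set i : 'I_r | (i < k)%N && (p k < p i)%N]| in
               rev (iota (k - c) c) | k : 'I_r <- enum 'I_r].

Definition perm_term r (p : 'S_r) : term r r := word_term r (perm_word p).

Definition antisym_term r : term r r :=
  \big[@Add R m r r / Zero r r]_(p : 'S_r) Scale ((-1) ^+ p) (perm_term p).

End Terms.

Section PermWord.
Local Open Scope group_scope.

Definition simple_tperm r i : 'S_r :=
  if (insub i : option 'I_r, insub i.+1 : option 'I_r) is (Some a, Some b)
  then tperm a b else 1.

Lemma simple_tpermE r i (x : 'I_r) : (i.+1 < r)%N ->
  simple_tperm r i x =
    (if x == i :> nat then i.+1 else if x == i.+1 :> nat then i else x) :> nat.
Proof.
move=> ltir; rewrite /simple_tperm.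
rewrite (insubT (fun j => j < r)%N (ltnW ltir)) (insubT (fun j => j < r)%N ltir).
by rewrite permE /= -!val_eqE /=; case: eqP => // _; case: eqP.
Qed.

Lemma prod_rev_iotaE r k c (x : 'I_r) : (k < r)%N -> (c <= k)%N ->
  (\prod_(i <- rev (iota (k - c) c)) simple_tperm r i) x =
    (if x == k :> nat then (k - c)%N
     else if (k - c <= x < k)%N then x.+1 else x) :> nat.
Proof.
move=> ltkr; elim: c => [|c IHc] lec.
  by rewrite big_nil perm1 subn0; case: eqP => // _; case: ifP => //; lia.
rewrite /= rev_cons big_rcons /= permM.
have e : (k - c.+1).+1 = (k - c)%N by lia.
rewrite e simple_tpermE; last by lia.
rewrite (IHc (ltnW lec)) e.
by do !case: ifP; lia.
Qed.

Lemma perm_wordP r (p : 'S_r) :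
  \prod_(i <- perm_word p) simple_tperm r i = p.
Proof.
pose N (k : nat) (x : 'I_r) := #|[set i : 'I_r | (i < k)%N && (p i < p x)%N]|.
pose w (k : 'I_r) := let c := #|[set i : 'I_r | (i < k)%N && (p k < p i)%N]| in
  rev (iota (k - c) c).
have ltS (k : nat) (ltkr : (k < r)%N) (P : pred 'I_r) :
    #|[set i : 'I_r | (i < k.+1)%N && P i]| =
    (#|[set i : 'I_r | (i < k)%N && P i]| + P (Ordinal ltkr))%N.
  rewrite (cardsD1 (Ordinal ltkr)) inE /= ltnSn /= addnC; congr (_ + _)%N.
  apply: eq_card => i; rewrite !inE -val_eqE /= ltnS ltn_neqAle.
  by rewrite -andbA.
have card_lt (k : nat) : (k <= r)%N -> #|[set i : 'I_r | (i < k)%N]| = k.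
  elim: k => [|k IHk] ltkr; first by apply: eq_card0 => i; rewrite inE.
  have /= := ltS k ltkr predT; under eq_finset do rewrite andbT.
  by move=> ->; under eq_finset do rewrite andbT; rewrite IHk ?addn1 // ltnW.
have main k : (k <= r)%N -> forall x,
    (\prod_(i <- flatten [seq w k | k <- take k (enum 'I_r)])
       simple_tperm r i) x = (if (x < k)%N then N k x else x) :> nat.
  elim: k => [|k IHk] ltkr x; first by rewrite take0 big_nil perm1.
  pose K := Ordinal ltkr.
  have {}IHk := IHk (ltnW ltkr) x.
  have szk : (k < size (enum 'I_r))%N by rewrite size_enum_ord.
  rewrite (take_nth K szk) map_rcons flatten_rcons big_cat /= permM.
  have -> : nth K (enum 'I_r) k = K by apply: val_inj; rewrite /= nth_enum_ord.
  set y := (fun_of_perm _ x) in IHk *.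
  pose c := #|[set i : 'I_r | (i < k)%N && (p K < p i)%N]|.
  have cN : (N k K + c = k)%N.
    rewrite -[RHS](card_lt k (ltnW ltkr)) -cardsUI.
    rewrite [X in (_ + X)%N]eq_card0 ?addn0; last by move=> i; rewrite !inE; lia.
    apply: eq_card => i; rewrite !inE -andb_orr -neq_ltn.
    rewrite (inj_eq val_inj) (inj_eq perm_inj) -val_eqE /=.
    by case: ltngtP.
  rewrite /w /= -/c prod_rev_iotaE // ?IHk; last by lia.
  have NS : N k.+1 x = (N k x + (p K < p x))%N by apply: ltS.
  rewrite NS.
  have [ltxk|ltkx|exk] := ltngtP x k.
  - have neK : (p x == p K :> nat) = false.
      by rewrite (inj_eq val_inj) (inj_eq perm_inj) -val_eqE /= (ltn_eqF ltxk).
    have Nlt : (N k x < k)%N.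
      rewrite -[X in (_ < X)%N](card_lt k (ltnW ltkr)); apply: proper_card.
      apply/properP; split; first by apply/subsetP => i; rewrite !inE; lia.
      by exists x; rewrite !inE ?ltnn ?andbF.
    have le1 : (p K < p x)%N -> (N k K <= N k x)%N.
      by move=> ltp; apply: subset_leq_card; apply/subsetP => i; rewrite !inE; lia.
    have le2 : (p x < p K)%N -> (N k x < N k K)%N.
      move=> ltp; apply: proper_card; apply/properP; split.
        by apply/subsetP => i; rewrite !inE; lia.
      by exists x; rewrite !inE ?ltnn ?andbF ?ltxk ?ltp.
    case: (ltngtP (p K) (p x)) neK => [lt|lt|//] neK.
      by have := le1 lt; do !case: ifP; lia.
    by have := le2 lt; do !case: ifP; lia.
  - by rewrite gtn_eqF // ltnS (leqNgt x k) (ltnNge x k) ltkx (ltnW ltkx) andbF.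
  - have -> : x = K by apply: val_inj.
    by rewrite eqxx ltnS leqnn ltnn addn0 -[X in (X - _)%N]cN addnK.
apply/permP => x; apply: val_inj => /=.
have := main r (leqnn r) x; rewrite take_oversize ?size_enum_ord // ltn_ord => ->.
rewrite /N; under eq_finset do rewrite ltn_ord /=.
rewrite -[RHS](card_lt (p x) (ltnW (ltn_ord _))) -[RHS](card_preimset _ (@perm_inj _ p)).
by apply: eq_card => i; rewrite !inE.
Qed.
End PermWord.

Section Relations.
Variables (R : comPzRingType) (m : nat) (delta : R).
Notation term := (term R m).

Inductive term_eq : forall r s, term r s -> term r s -> Prop :=
| te_refl r s (f : term r s) : term_eq f f
| te_sym r s (f g : term r s) : term_eq f g -> term_eq g f
| te_trans r s (f g h : term r s) : term_eq f g -> term_eq g h -> term_eq f h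
| te_comp r s t (f f' : term s t) (g g' : term r s) :
    term_eq f f' -> term_eq g g' -> term_eq (Comp f g) (Comp f' g')
| te_tens r s r' s' (f f' : term r s) (g g' : term r' s') :
    term_eq f f' -> term_eq g g' -> term_eq (Tens f g) (Tens f' g')
| te_star r s (f f' : term r s) :
    term_eq f f' -> term_eq (Star f) (Star f')
| te_add r s (f f' g g' : term r s) :
    term_eq f f' -> term_eq g g' -> term_eq (Add f g) (Add f' g')
| te_scale r s a (f f' : term r s) :
    term_eq f f' -> term_eq (Scale a f) (Scale a f')
| te_addA r s (f g h : term r s) :
    term_eq (Add f (Add g h)) (Add (Add f g) h)
| te_addC r s (f g : term r s) : term_eq (Add f g) (Add g f)
| te_add0 r s (f : term r s) : term_eq (Add (Zero r s) f) f
| te_addN r s (f : term r s) : term_eq (Add (Scale (-1) f) f) (Zero r s)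
| te_scaleA r s a b (f : term r s) :
    term_eq (Scale a (Scale b f)) (Scale (a * b) f)
| te_scale1 r s (f : term r s) : term_eq (Scale 1 f) f
| te_scaleDr r s a (f g : term r s) :
    term_eq (Scale a (Add f g)) (Add (Scale a f) (Scale a g))
| te_scaleDl r s a b (f : term r s) :
    term_eq (Scale (a + b) f) (Add (Scale a f) (Scale b f))
| te_compA r s t u (f : term t u) (g : term s t) (h : term r s) :
    term_eq (Comp f (Comp g h)) (Comp (Comp f g) h)
| te_comp1f r s (f : term r s) : term_eq (Comp (Id s) f) f
| te_compf1 r s (f : term r s) : term_eq (Comp f (Id r)) f
| te_compDl r s t (f g : term s t) (h : term r s) :
    term_eq (Comp (Add f g) h) (Add (Comp f h) (Comp g h))
| te_compDr r s t (f : term s t) (g h : term r s) :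
    term_eq (Comp f (Add g h)) (Add (Comp f g) (Comp f h))
| te_compZl r s t a (f : term s t) (g : term r s) :
    term_eq (Comp (Scale a f) g) (Scale a (Comp f g))
| te_compZr r s t a (f : term s t) (g : term r s) :
    term_eq (Comp f (Scale a g)) (Scale a (Comp f g))
| te_tens_comp r s t r' s' t' (f : term s t) (g : term r s)
    (f' : term s' t') (g' : term r' s') :
    term_eq (Tens (Comp f g) (Comp f' g')) (Comp (Tens f f') (Tens g g'))
| te_tens1 r s : term_eq (Tens (Id r) (Id s)) (Id (r + s))
| te_tensA r s r' s' r'' s'' (f : term r s) (g : term r' s')
    (h : term r'' s'') :
    term_eq (Tens (Tens f g) h)
      (cast_term (addnA r r' r'') (addnA s s' s'') (Tens f (Tens g h)))
| te_tens0f r s (f : term r s) : term_eq (Tens (Id 0) f) f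
| te_tensf0 r s (f : term r s) :
    term_eq (Tens f (Id 0)) (cast_term (esym (addn0 r)) (esym (addn0 s)) f)
| te_tensDl r s r' s' (f g : term r s) (h : term r' s') :
    term_eq (Tens (Add f g) h) (Add (Tens f h) (Tens g h))
| te_tensDr r s r' s' (f : term r s) (g h : term r' s') :
    term_eq (Tens f (Add g h)) (Add (Tens f g) (Tens f h))
| te_tensZl r s r' s' a (f : term r s) (g : term r' s') :
    term_eq (Tens (Scale a f) g) (Scale a (Tens f g))
| te_tensZr r s r' s' a (f : term r s) (g : term r' s') :
    term_eq (Tens f (Scale a g)) (Scale a (Tens f g))
| te_starK r s (f : term r s) : term_eq (Star (Star f)) f
| te_starD r s (f g : term r s) :
    term_eq (Star (Add f g)) (Add (Star f) (Star g))
| te_starZ r s a (f : term r s) :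
    term_eq (Star (Scale a f)) (Scale a (Star f))
| te_star_comp r s t (f : term s t) (g : term r s) :
    term_eq (Star (Comp f g)) (Comp (Star g) (Star f))
| te_star_tens r s r' s' (f : term r s) (g : term r' s') :
    term_eq (Star (Tens f g)) (Tens (Star f) (Star g))
| te_star1 r : term_eq (Star (Id r)) (Id r)
| te_star_cross : term_eq (Star Cross) Cross
| te_star_cup : term_eq (Star Cup) Cap
| te_crossK : term_eq (Comp Cross Cross) (Tens (Id 1) (Id 1))
| te_braid :
    term_eq
      (Comp (Tens Cross (Id 1)) (Comp (Tens (Id 1) Cross) (Tens Cross (Id 1))))
      (Comp (Tens (Id 1) Cross) (Comp (Tens Cross (Id 1)) (Tens (Id 1) Cross)))
| te_cap_cross : term_eq (Comp Cap Cross) Cap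
| te_cross_cup : term_eq (Comp Cross Cup) Cup
| te_loop : term_eq (Comp Cap Cup) (Scale delta (Id 0))
| te_cap_slide :
    term_eq (Comp (Tens Cap (Id 1)) (Tens (Id 1) Cross))
            (Comp (Tens (Id 1) Cap) (Tens Cross (Id 1)))
| te_cup_slide :
    term_eq (Comp (Tens (Id 1) Cross) (Tens Cup (Id 1)))
            (Comp (Tens Cross (Id 1)) (Tens (Id 1) Cup))
| te_zigzagl : term_eq (Comp (Tens Cap (Id 1)) (Tens (Id 1) Cup)) (Id 1)
| te_zigzagr : term_eq (Comp (Tens (Id 1) Cap) (Tens Cup (Id 1))) (Id 1)
| te_harmonic i j (e : (i + 2 + j)%N = m) :
    term_eq (Comp (cast_term e erefl (pad i j Cap)) Delta) (Zero 0 (i + 0 + j))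
| te_alternating i j (e : (i + 2 + j)%N = m) :
    term_eq (Comp (cast_term e e (pad i j Cross)) Delta) (Scale (-1) Delta)
| te_Delta : term_eq (Comp Delta (Star Delta)) (antisym_term R m m).

End Relations.

Section Hom.
Variables (R : comPzRingType) (m : nat) (delta : R).

HB.instance Definition _ r s := gen_eqMixin (term R m r s).
HB.instance Definition _ r s := gen_choiceMixin (term R m r s).

Section Quotient.
Variables r s : nat.

Definition term_eqb : rel (term R m r s) := fun f g => `[< term_eq delta f g >].

Lemma term_eqb_refl : reflexive term_eqb.
Proof. by move=> f; apply/asboolP/te_refl. Qed.

Lemma term_eqb_sym : symmetric term_eqb.
Proof. by move=> f g; apply/asboolP/asboolP => /te_sym. Qed.

Lemma term_eqb_trans : transitive term_eqb.
Proof. by move=> g f h /asboolP fg /asboolP gh; apply/asboolP/(te_trans fg gh). Qed.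

Canonical term_equiv : equiv_rel (term R m r s) :=
  EquivRel term_eqb term_eqb_refl term_eqb_sym term_eqb_trans.

Definition hom : Type := {eq_quot term_equiv}.

HB.instance Definition _ := Quotient.on hom.
HB.instance Definition _ := Choice.on hom.

Definition cls (f : term R m r s) : hom := \pi_hom f.

Lemma cls_eq (f g : term R m r s) : cls f = cls g <-> term_eq delta f g.
Proof.
split=> [/eqP|fg]; first by rewrite eqmodE => /asboolP.
by apply/eqP; rewrite eqmodE; apply/asboolP.
Qed.

Lemma cls_repr (x : hom) : cls (repr x) = x.
Proof. exact: reprK. Qed.

Lemma repr_cls (f : term R m r s) : term_eq delta (repr (cls f)) f.
Proof. by apply/cls_eq; rewrite cls_repr. Qed.

Definition hom_zero : hom := cls (Zero r s).
Definition hom_add (x y : hom) : hom := cls (Add (repr x) (repr y)).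
Definition hom_scale (a : R) (x : hom) : hom := cls (Scale a (repr x)).
Definition hom_opp : hom -> hom := hom_scale (-1).

Lemma hom_addE f g : hom_add (cls f) (cls g) = cls (Add f g).
Proof. by apply/cls_eq; apply: te_add; apply: repr_cls. Qed.

Lemma hom_scaleE a f : hom_scale a (cls f) = cls (Scale a f).
Proof. by apply/cls_eq; apply: te_scale; apply: repr_cls. Qed.

Lemma hom_addA : associative hom_add.
Proof.
move=> x y z; rewrite -(cls_repr x) -(cls_repr y) -(cls_repr z) !hom_addE.
exact/cls_eq/te_addA.
Qed.

Lemma hom_addC : commutative hom_add.
Proof.
move=> x y; rewrite -(cls_repr x) -(cls_repr y) !hom_addE.
exact/cls_eq/te_addC.
Qed.

Lemma hom_add0 : left_id hom_zero hom_add.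
Proof. by move=> x; rewrite -(cls_repr x) hom_addE; apply/cls_eq/te_add0. Qed.

Lemma hom_addN : left_inverse hom_zero hom_opp hom_add.
Proof.
move=> x; rewrite -(cls_repr x) /hom_opp hom_scaleE hom_addE.
exact/cls_eq/te_addN.
Qed.

HB.instance Definition _ :=
  GRing.isZmodule.Build hom hom_addA hom_addC hom_add0 hom_addN.

Lemma hom_scaleA a b (x : hom) : hom_scale a (hom_scale b x) = hom_scale (a * b) x.
Proof. by rewrite -(cls_repr x) !hom_scaleE; apply/cls_eq/te_scaleA. Qed.

Lemma hom_scale1 : left_id 1 hom_scale.
Proof. by move=> x; rewrite -(cls_repr x) hom_scaleE; apply/cls_eq/te_scale1. Qed.

Lemma hom_scaleDr : right_distributive hom_scale +%R.
Proof.
move=> a x y; rewrite -(cls_repr x) -(cls_repr y) [X in hom_scale a X]hom_addE.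
by rewrite !hom_scaleE [RHS]hom_addE; apply/cls_eq/te_scaleDr.
Qed.

Lemma hom_scaleDl (x : hom) : {morph hom_scale^~ x : a b / a + b}.
Proof.
move=> a b; rewrite -(cls_repr x) !hom_scaleE [RHS]hom_addE.
exact/cls_eq/te_scaleDl.
Qed.

HB.instance Definition _ := GRing.Zmodule_isLmodule.Build R hom
  hom_scaleA hom_scale1 hom_scaleDr hom_scaleDl.

End Quotient.

Definition hom_id r : hom r r := cls (Id r).

Definition hom_comp r s t (x : hom s t) (y : hom r s) : hom r t :=
  cls (Comp (repr x) (repr y)).

Definition hom_tens r s r' s' (x : hom r s) (y : hom r' s') :
  hom (r + r') (s + s') := cls (Tens (repr x) (repr y)).

Definition hom_star r s (x : hom r s) : hom s r := cls (Star (repr x)).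

Lemma hom_compE r s t (f : term R m s t) (g : term R m r s) :
  hom_comp (cls f) (cls g) = cls (Comp f g).
Proof. by apply/cls_eq; apply: te_comp; apply: repr_cls. Qed.

Lemma hom_tensE r s r' s' (f : term R m r s) (g : term R m r' s') :
  hom_tens (cls f) (cls g) = cls (Tens f g).
Proof. by apply/cls_eq; apply: te_tens; apply: repr_cls. Qed.

Lemma hom_starE r s (f : term R m r s) : hom_star (cls f) = cls (Star f).
Proof. by apply/cls_eq; apply: te_star; apply: repr_cls. Qed.

Definition antisym r : hom r r := cls (antisym_term R m r).

Lemma antisymE r :
  antisym r = \sum_(p : 'S_r) (-1) ^+ p *: cls (perm_term R m p).
Proof.
rewrite /antisym /antisym_term; elim/big_rec2: _ => [//|p x f _ <-].
by rewrite -[LHS]hom_addE -hom_scaleE.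
Qed.

(* This holds over a field, but not over every domain, since the relations can
   create torsion: for R = int, m = 2 and delta = 5 the category has a functor
   to vector spaces over 'F_3 with antisym 2 acting nontrivially, although
   3 *: antisym 2 = 0. *)
Definition hom_torsion_free r s : Prop :=
  forall (a : R) (x : hom r s), a *: x = 0 -> a = 0 \/ x = 0.

End Hom.

Section FPoly.
Variables (R : comNzRingType) (m : nat).

Definition f_poly : {poly R} :=
  \prod_(1 <= i < m) ('X - i%:R%:P) - (m.-1)`!%:R%:P.

End FPoly.

(* Main.v *)
From HB Require Import structures.
Require Import Defs.
From mathcomp Require Import all_boot all_order all_algebra all_fingroup.
From mathcomp Require Import zify.

Set Implicit Arguments.
Unset Strict Implicit.
Unset Printing Implicit Defensive.

Import GRing.Theory.
Local Open Scope ring_scope.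

(** Write S_r for the antisymmetriser on r strands, x for the tensor product, D
    for Delta and D* for its reflection, so that D o D* = S_m.

    Two facts hold in any category with these crossings, cups and caps.  First,
    S_(r+1) = C_r o (S_r x I), where C_r is the signed sum of the coset
    representatives s_(r-c) ... s_(r-1) of Sym_r in Sym_(r+1); with the Coxeter
    relations this makes S_r antisymmetric on both sides.  Secondly, closing
    the last strand sends S_(r+1) to (delta - r) S_r ([ptrace_antisym]).

    The relation D o D* = S_m enters once.  Since S_(m+1) absorbs I x S_m on
    either side, up to the factor m!,
      m!^2 S_(m+1) = (I x S_m) S_(m+1) (I x S_m) = kappa x S_m,
    where kappa = (I x D* ) S_(m+1) (I x D) is an endomorphism of one strand
    ([antisym_kappa]).  The strands of S_m can now be closed one after the
    other from the right, without touching kappa ([antisym_kappa_trace]):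
      a_r (kappa x S_r) = b_r S_(r+1)   for r <= m,
      a_r = product of delta - i over r <= i < m,
      b_r = m!^2 times the product of delta - i over r < i <= m.

    If delta were some q with 0 < q < m, then a_q = 0 while b_q, which is
    m!^2 (m - q)! up to sign, is nonzero; hence S_(q+1), and therefore S_m,
    would be killed by a nonzero scalar.  So a_1 is nonzero.  For r = 1 the
    identity reads a_1 (kappa x I) = b_1 (1 - X); composing with the cup gives
    a_1 (kappa x I) o U = 0, and bending the cup back gives a_1 kappa = 0.
    Therefore S_(m+1) = 0, and closing its last strand gives
    (delta - m) S_m = 0, that is delta = m.  Finally f_m(m) = 0, so that both
    sides of the first assertion vanish. *)

(** * Alternating sums in a ring satisfying the Coxeter relations *)

Section CoxeterRing.
Variables (A : pzRingType) (s : nat -> A).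

(** The signed sum of the words s_(k-c) ... s_(k-1), c <= k, which represent the
    cosets of Sym_k in Sym_(k+1); see [coset_sumE]. *)
Fixpoint coset_sum k : A := if k is j.+1 then 1 - coset_sum j * s j else 1.

Fixpoint alternator r : A :=
  if r is k.+1 then coset_sum k * alternator k else 1.

Definition coxeter_relations n :=
  [/\ forall i, (i.+1 < n)%N -> s i * s i = 1,
      forall i, (i.+2 < n)%N -> s i * s i.+1 * s i = s i.+1 * s i * s i.+1
    & forall i j, (i.+1 < j)%N -> (j.+1 < n)%N -> s i * s j = s j * s i].

(** Each of the k + 1 words acts on an antisymmetric element by its sign. *)
Lemma mul_coset_suml k (z : A) : (forall i, (i < k)%N -> s i * z = - z) ->
  coset_sum k * z = z *+ k.+1.
Proof.
elim: k => [|k IHk] sz; first by rewrite mul1r.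
rewrite /= mulrBl mul1r -mulrA sz // mulrN IHk => [|i ltik]; last exact/sz/ltnW.
by rewrite opprK -mulrS.
Qed.

Lemma mul_alternatorl r (z : A) :
  (forall i, (i.+1 < r)%N -> s i * z = - z) -> alternator r * z = z *+ r`!.
Proof.
elim: r => [|r IHr] sz; first by rewrite mul1r.
rewrite /= -mulrA IHr => [|i lt]; last exact/sz/ltnW.
by rewrite mulrnAr mul_coset_suml // -mulrnA factS mulnC.
Qed.

Lemma mul_coset_sumr k (z : A) : (forall i, (i < k)%N -> z * s i = - z) ->
  z * coset_sum k = z *+ k.+1.
Proof.
elim: k => [|k IHk] zs; first by rewrite mulr1.
rewrite /= mulrBr mulr1 mulrA IHk => [|i ltik]; last exact/zs/ltnW.
by rewrite mulrnAl zs // mulNrn opprK -mulrS.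
Qed.

Lemma mul_alternatorr r (z : A) :
  (forall i, (i.+1 < r)%N -> z * s i = - z) -> z * alternator r = z *+ r`!.
Proof.
elim: r => [|r IHr] zs; first by rewrite mulr1.
rewrite /= mulrA mul_coset_sumr // mulrnAl IHr => [|i lt]; last exact/zs/ltnW.
by rewrite -mulrnA factS mulnC.
Qed.

Variable n : nat.
Hypothesis cox : coxeter_relations n.

Let sK i : (i.+1 < n)%N -> s i * s i = 1.
Proof. by case: cox => + _ _; apply. Qed.
Let braid i : (i.+2 < n)%N -> s i * s i.+1 * s i = s i.+1 * s i * s i.+1.
Proof. by case: cox => _ + _; apply. Qed.
Let far i j : (i.+1 < j)%N -> (j.+1 < n)%N -> s i * s j = s j * s i.
Proof. by case: cox => _ _; apply. Qed.

Lemma coset_sum_comm k j : (k < j)%N -> (j.+1 < n)%N ->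
  coset_sum k * s j = s j * coset_sum k.
Proof.
elim: k => [|k IHk] /= ltkj ltjn; first by rewrite mul1r mulr1.
rewrite mulrBl mulrBr mul1r mulr1 -mulrA far // !mulrA IHk //; exact: ltnW.
Qed.

Lemma alternator_comm k j : (k <= j)%N -> (j.+1 < n)%N ->
  alternator k * s j = s j * alternator k.
Proof.
elim: k => [|k IHk] /= lekj ltjn; first by rewrite mul1r mulr1.
by rewrite -mulrA IHk ?(ltnW lekj) // !mulrA coset_sum_comm.
Qed.

(** Left multiplication by s_j permutes the cosets, up to right multiplication
    by some s_i.  Letting z vary makes the induction work: the case of a larger
    k applies the lemma to s_k z, which is antisymmetric under all s_i far
    from s_k. *)
Lemma coset_sum_antisym k (z : A) j :
    (k < n)%N -> (forall i, (i.+1 < k)%N -> s i * z = - z) -> (j < k)%N ->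
  s j * (coset_sum k * z) = - (coset_sum k * z).
Proof.
elim: k z j => // k IHk z j ltkn sz; rewrite /= ltnS leq_eqVlt.
rewrite mulrBl mul1r -mulrA => /predU1P[-> | ltjk]; last first.
  rewrite mulrBr sz // IHk ?(ltnW ltkn) // ?opprD // => i ltik.
  by rewrite mulrA far // -mulrA sz ?mulrN // ltnW.
case: k IHk ltkn sz => [|k] _ ltkn sz /=.
  by rewrite mul1r mulrBr mulrA sK // mul1r opprB.
have tz : s k * z = - z by rewrite sz.
rewrite mulrBl mul1r !mulrBr !mulrA sK // mul1r -coset_sum_comm //.
rewrite -!(mulrA (coset_sum k)) -braid //.
rewrite -!mulrA tz !mulrN; set u := s k.+1 * z; set v := coset_sum k * _.
by rewrite opprK opprB opprD addrA addrAC.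
Qed.

Lemma alternator_antisyml r j : (r <= n)%N -> (j.+1 < r)%N ->
  s j * alternator r = - alternator r.
Proof.
elim: r j => // r IHr j ltrn ltjr; apply: coset_sum_antisym => // i ltir.
exact/IHr/ltir/ltnW.
Qed.

(** In terms of permutations, the product of two successive coset sums is the
    signed sum of the shortest representatives of the cosets of Sym_k in
    Sym_(k+2); these are permuted by right multiplication with the
    transposition of the last two points, which commutes with Sym_k. *)
Lemma coset_sum2_antisym k : (k.+1 < n)%N ->
  coset_sum k.+1 * coset_sum k * s k = - (coset_sum k.+1 * coset_sum k).
Proof.
elim: k => [|k IHk] ltkn.
  by rewrite /= !mul1r !mulr1 mulrBl mul1r sK // opprB.
set C2 := coset_sum k.+2; set C1 := coset_sum k.+1; set C := coset_sum k.
set t := s k; set u := s k.+1.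
have uC : C * u = u * C by apply: coset_sum_comm.
have eC1 : C1 = 1 - C * t by [].
have eC2 : C2 = 1 - C1 * u by [].
have uu : u * u = 1 by apply: sK.
have tut : t * u * t = u * t * u by apply: braid.
have {IHk}e : C1 * C * t = - (C1 * C) by apply/IHk/ltnW.
(* It suffices that C2 * C1 * (1 + u) = 0. *)
apply: (addIr (C2 * C1)); rewrite addNr -[X in _ + X]mulr1 -mulrDr.
have utu : u * t * (u + 1) = (t + 1) * (u * t).
  by rewrite mulrDr mulr1 -tut mulrDl mul1r !mulrA.
have h : u * C1 * (u + 1) = u + 1 - C * ((t + 1) * (u * t)).
  rewrite eC1 mulrBr mulr1 mulrA -uC mulrBl mulrDr uu mulr1 (addrC 1).
  by rewrite -!mulrA (mulrA u) utu.
have key : C1 * u * C1 * (u + 1) = C1 * (u + 1).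
  rewrite -!mulrA (mulrA u) h mulrBr !mulrA (mulrDr _ t) mulr1 e addNr.
  by rewrite !mul0r subr0.
by rewrite eC2 mulrBl mul1r mulrBl key subrr.
Qed.

Lemma alternator_antisymr r j : (r <= n)%N -> (j.+1 < r)%N ->
  alternator r * s j = - alternator r.
Proof.
elim: r j => // r IHr j ltn; rewrite ltnS leq_eqVlt.
move=> /predU1P[e|ltjr]; first rewrite -e in ltn *.
  rewrite -[alternator _]/(coset_sum j.+1 * (coset_sum j * alternator j)).
  by rewrite -!mulrA alternator_comm // !mulrA coset_sum2_antisym // mulNr.
by rewrite /= -mulrA IHr ?mulrN // ltnW.
Qed.

End CoxeterRing.

(** * The sum over permutations *)

Section Words.
Variables (A : pzRingType) (s : nat -> A).

Lemma coset_sumE k : coset_sum s k =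
  \sum_(c < k.+1) (-1) ^+ c * \prod_(i <- iota (k - c) c) s i.
Proof.
elim: k => [|k IHk]; first by rewrite big_ord1 big_nil mulr1.
rewrite big_ord_recl big_nil mulr1 -[coset_sum s _]/(1 - coset_sum s k * s k).
rewrite IHk mulr_suml -sumrN; congr (_ + _); apply: eq_bigr => c _.
have -> : iota (k.+1 - lift ord0 c) (lift ord0 c) = rcons (iota (k - c) c) k.
  by rewrite lift0 subSS -(addn1 c) iotaD cats1 subnK // -ltnS.
by rewrite big_rcons lift0 exprS -!mulrA mulN1r.
Qed.

(** These numbers form the Lehmer code of p, from which [perm_word] is built. *)
Definition inversions r (p : 'S_r) (k : 'I_r) : nat :=
  #|[set i : 'I_r | (i < k)%N && (p k < p i)%N]|.

Lemma inversions_le r (p : 'S_r) k : (inversions p k <= k)%N.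
Proof.
rewrite /inversions cardE -(size_map val) -[X in (_ <= X)%N](size_iota 0 k).
apply: uniq_leq_size => [|_ /mapP[i + ->]]; last first.
  by rewrite mem_enum mem_iota inE => /andP[].
by rewrite map_inj_uniq ?enum_uniq //; apply: val_inj.
Qed.

Definition lehmer r (p : 'S_r) : {ffun 'I_r -> 'I_r} :=
  [ffun k => Ordinal (leq_ltn_trans (inversions_le p k) (ltn_ord k))].

Definition code_word r (c : {ffun 'I_r -> 'I_r}) : seq nat :=
  flatten [seq rev (iota (k - c k) (c k)) | k : 'I_r <- enum 'I_r].

Lemma perm_wordE r (p : 'S_r) : perm_word p = code_word (lehmer p).
Proof. by congr flatten; apply: eq_map => k; rewrite ffunE. Qed.

Lemma lehmer_inj r : injective (@lehmer r).
Proof.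
move=> p q eqc; rewrite -[p]perm_wordP -[q]perm_wordP.
by rewrite !perm_wordE eqc.
Qed.

Definition codes r := [set c : {ffun 'I_r -> 'I_r} | [forall k, (c k <= k)%N]].

(** Codes are counted so that injectivity of the Lehmer code makes it a
    bijection onto them. *)
Lemma card_codes r : #|codes r| = r`!.
Proof.
have -> : #|codes r| = #|family (fun k : 'I_r => [pred j : 'I_r | (j <= k)%N])|.
  apply: eq_card => c; rewrite inE.
  by apply/forallP/familyP => leck k; have := leck k.
rewrite card_family foldrE big_map big_enum /= fact_prod big_add1 big_mkord.
apply: eq_bigr => k _; rewrite -sum1_card -[RHS]card_ord -sum1_card.
by rewrite (big_ord_widen r (fun=> 1%N)).
Qed.

Lemma lehmer_codes r : @lehmer r @: [set: 'S_r] = codes r.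
Proof.
apply/eqP; rewrite eqEcard card_codes card_imset; last exact: lehmer_inj.
rewrite cardsT card_Sn leqnn andbT; apply/subsetP => _ /imsetP[p _ ->].
by rewrite inE; apply/forallP => k; rewrite ffunE inversions_le.
Qed.

(** The word is a product of transpositions for p, so its length has the parity
    of p. *)
Lemma odd_perm_word r (p : 'S_r) : odd_perm p = odd (size (perm_word p)).
Proof.
rewrite -[in LHS](perm_wordP p).
have : all (fun i => i.+1 < r)%N (perm_word p).
  apply/allP => i /flattenP[_ /mapP[k _ ->]]; rewrite mem_rev mem_iota.
  rewrite subnK ?(inversions_le p k) // => /andP[_ ltik].
  exact: leq_ltn_trans (ltn_ord k).
elim: (perm_word p) => [|i w IHw] /=; first by rewrite big_nil odd_perm1.
move=> /andP[lti allw]; rewrite big_cons odd_permM IHw // -addbT addbC.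
congr addb.
rewrite /simple_tperm (insubT (fun j => j < r)%N (ltnW lti)).
by rewrite (insubT (fun j => j < r)%N lti) odd_tperm -val_eqE /= neq_ltn ltnSn.
Qed.

(** Expanding the product of the coset sums gives one word for each Lehmer code,
    hence one for each permutation.  The factors of the product are stacked in
    the order opposite to that of the letters, so the expansion takes place in
    the converse ring. *)
Lemma alternatorE r : alternator s r =
  \sum_(p : 'S_r) (-1) ^+ p * \prod_(i <- rev (perm_word p)) s i.
Proof.
pose P (w : seq nat) : A := \prod_(i <- w) (- s i : A^c).
have PE w : P w = (-1) ^+ odd (size w) * \prod_(i <- rev w) s i.
  rewrite signr_odd; elim: w => [|i w IHw]; first by rewrite /P !big_nil mulr1.
  have -> : P (i :: w) = P w * - s i by rewrite /P big_cons.
  rewrite rev_cons big_rcons /= IHw.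
  by rewrite mulrN exprS mulN1r mulNr mulrA.
have altE : alternator s r = \prod_(k < r) (coset_sum s k : A^c).
  by elim: r => [|r IHr]; rewrite ?big_ord0 // big_ord_recr /= IHr.
have cosE (k : 'I_r) : (coset_sum s k : A^c) =
    \sum_(c : 'I_r | (c <= k)%N) P (rev (iota (k - c) c)).
  rewrite coset_sumE; pose G c := (-1) ^+ c * \prod_(i <- iota (k - c) c) s i.
  rewrite (big_ord_widen r G) //.
  by apply: eq_bigr => c _; rewrite PE revK size_rev size_iota signr_odd.
rewrite altE (eq_bigr _ (fun k _ => cosE k)) bigA_distr_big_dep.
rewrite -(eq_bigl _ _ (fun c => in_set _ c)).
rewrite (eq_bigl (mem (codes r))) => [|c]; last first.
  by rewrite !inE; apply/familyP/forallP => leck k; have := leck k.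
rewrite -lehmer_codes big_imset /=; last by move=> p q _ _; apply: lehmer_inj.
apply: eq_big => [p|p _]; first by rewrite inE.
rewrite odd_perm_word -PE perm_wordE /P /code_word big_flatten big_map.
by rewrite enumT [index_enum _]unlock.
Qed.
End Words.

(** * The category: composition, tensor product and transport *)

Reserved Notation "f @@ g" (at level 40, left associativity).
Reserved Notation "f ** g" (at level 38, left associativity).

Section Category.
Variables (R : comPzRingType) (m : nat) (delta : R).
Local Notation hom := (Defs.hom m delta).
Local Notation "f @@ g" := (hom_comp f g).
Local Notation "f ** g" := (hom_tens f g).
Local Notation idm := (hom_id m delta).
Local Notation cls := (cls delta).
Local Notation antisym := (antisym m delta).

Lemma comp_assoc r s t u (x : hom t u) (y : hom s t) (z : hom r s) :
  x @@ (y @@ z) = x @@ y @@ z.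
Proof.
rewrite -(cls_repr x) -(cls_repr y) -(cls_repr z) !hom_compE.
exact/cls_eq/te_compA.
Qed.

Lemma comp1h r s (x : hom r s) : idm s @@ x = x.
Proof. by rewrite -(cls_repr x) hom_compE; apply/cls_eq/te_comp1f. Qed.

Lemma comph1 r s (x : hom r s) : x @@ idm r = x.
Proof. by rewrite -(cls_repr x) hom_compE; apply/cls_eq/te_compf1. Qed.

Lemma compDl r s t (x y : hom s t) (z : hom r s) :
  (x + y) @@ z = x @@ z + y @@ z.
Proof.
rewrite -(cls_repr x) -(cls_repr y) -(cls_repr z) -[_ + _]/(hom_add _ _).
rewrite -[RHS]/(hom_add _ _) hom_addE !hom_compE hom_addE.
exact/cls_eq/te_compDl.
Qed.

Lemma compDr r s t (z : hom s t) (x y : hom r s) :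
  z @@ (x + y) = z @@ x + z @@ y.
Proof.
rewrite -(cls_repr x) -(cls_repr y) -(cls_repr z) -[_ + _]/(hom_add _ _).
rewrite -[RHS]/(hom_add _ _) hom_addE !hom_compE hom_addE.
exact/cls_eq/te_compDr.
Qed.

Lemma compZl r s t a (x : hom s t) (y : hom r s) :
  (a *: x) @@ y = a *: (x @@ y).
Proof.
rewrite -(cls_repr x) -(cls_repr y) -[_ *: cls _]/(hom_scale _ _).
rewrite -[RHS]/(hom_scale _ _) hom_scaleE !hom_compE hom_scaleE.
exact/cls_eq/te_compZl.
Qed.

Lemma compZr r s t a (x : hom s t) (y : hom r s) :
  x @@ (a *: y) = a *: (x @@ y).
Proof.
rewrite -(cls_repr x) -(cls_repr y) -[_ *: cls _]/(hom_scale _ _).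
rewrite -[RHS]/(hom_scale _ _) hom_scaleE !hom_compE hom_scaleE.
exact/cls_eq/te_compZr.
Qed.

Lemma tensDl r s r' s' (x y : hom r s) (z : hom r' s') :
  (x + y) ** z = x ** z + y ** z.
Proof.
rewrite -(cls_repr x) -(cls_repr y) -(cls_repr z) -[_ + _]/(hom_add _ _).
rewrite -[RHS]/(hom_add _ _) hom_addE !hom_tensE hom_addE.
exact/cls_eq/te_tensDl.
Qed.

Lemma tensDr r s r' s' (z : hom r s) (x y : hom r' s') :
  z ** (x + y) = z ** x + z ** y.
Proof.
rewrite -(cls_repr x) -(cls_repr y) -(cls_repr z) -[_ + _]/(hom_add _ _).
rewrite -[RHS]/(hom_add _ _) hom_addE !hom_tensE hom_addE.
exact/cls_eq/te_tensDr.
Qed.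

Lemma tensZl r s r' s' a (x : hom r s) (y : hom r' s') :
  (a *: x) ** y = a *: (x ** y).
Proof.
rewrite -(cls_repr x) -(cls_repr y) -[_ *: cls _]/(hom_scale _ _).
rewrite -[RHS]/(hom_scale _ _) hom_scaleE !hom_tensE hom_scaleE.
exact/cls_eq/te_tensZl.
Qed.

Lemma tensZr r s r' s' a (x : hom r s) (y : hom r' s') :
  x ** (a *: y) = a *: (x ** y).
Proof.
rewrite -(cls_repr x) -(cls_repr y) -[_ *: cls _]/(hom_scale _ _).
rewrite -[RHS]/(hom_scale _ _) hom_scaleE !hom_tensE hom_scaleE.
exact/cls_eq/te_tensZr.
Qed.

Lemma tens_comp r s t r' s' t' (x : hom s t) (y : hom r s) (x' : hom s' t')
    (y' : hom r' s') :
  (x @@ y) ** (x' @@ y') = x ** x' @@ y ** y'.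
Proof.
rewrite -(cls_repr x) -(cls_repr y) -(cls_repr x') -(cls_repr y').
rewrite !(hom_compE, hom_tensE); exact/cls_eq/te_tens_comp.
Qed.

Lemma tens_id r s : idm r ** idm s = idm (r + s).
Proof. by rewrite hom_tensE; apply/cls_eq/te_tens1. Qed.

Lemma tens0h r s (x : hom r s) : idm 0 ** x = x.
Proof. by rewrite -(cls_repr x) hom_tensE; apply/cls_eq/te_tens0f. Qed.

Lemma zero_comp r s t (y : hom r s) : (0 : hom s t) @@ y = 0.
Proof. by rewrite -(scale0r 0) compZl scale0r. Qed.

Lemma comp_zero r s t (x : hom s t) : x @@ (0 : hom r s) = 0.
Proof. by rewrite -(scale0r 0) compZr scale0r. Qed.

Lemma zero_tens r s r' s' (y : hom r' s') : (0 : hom r s) ** y = 0.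
Proof. by rewrite -(scale0r 0) tensZl scale0r. Qed.

(** Associativity of the tensor product only holds along equalities between
    sums of naturals; these transports are kept explicit and merged. *)
Definition hcast r r' s s' (er : r = r') (es : s = s') (x : hom r s) :
    hom r' s' :=
  ecast k (hom k s') er (ecast k (hom r k) es x).

Lemma cls_cast r r' s s' (er : r = r') (es : s = s') (f : term R m r s) :
  cls (cast_term er es f) = hcast er es (cls f).
Proof. by case: r' / er; case: s' / es. Qed.

Lemma hcast_id r s (er : r = r) (es : s = s) (x : hom r s) : hcast er es x = x.
Proof. by rewrite !eq_axiomK. Qed.

Lemma hcast_hcast r r' r'' s s' s'' (er : r = r') (es : s = s')
    (er' : r' = r'') (es' : s' = s'') (x : hom r s) :
  hcast er' es' (hcast er es x) = hcast (etrans er er') (etrans es es') x.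
Proof. by case: r'' / er'; case: s'' / es'; case: r' / er; case: s' / es. Qed.

Lemma hcast_irr r r' s s' (er er' : r = r') (es es' : s = s') (x : hom r s) :
  hcast er es x = hcast er' es' x.
Proof. by rewrite (eq_irrelevance er er') (eq_irrelevance es es'). Qed.

Lemma hcast_comp r r' s s' t t' (er : r = r') (es : s = s') (et : t = t')
    (x : hom s t) (y : hom r s) :
  hcast er et (x @@ y) = hcast es et x @@ hcast er es y.
Proof. by case: r' / er; case: s' / es; case: t' / et. Qed.

Lemma hcast_idm r r' (e e' : r = r') : hcast e e' (idm r) = idm r'.
Proof. by rewrite (eq_irrelevance e' e); case: r' / e e'. Qed.

Lemma hcastZ r r' s s' (er : r = r') (es : s = s') a (x : hom r s) :
  hcast er es (a *: x) = a *: hcast er es x.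
Proof. by case: r' / er; case: s' / es. Qed.

Lemma hcastD r r' s s' (er : r = r') (es : s = s') (x y : hom r s) :
  hcast er es (x + y) = hcast er es x + hcast er es y.
Proof. by case: r' / er; case: s' / es. Qed.

Lemma tens_assoc r s r' s' r'' s'' (x : hom r s) (y : hom r' s')
    (z : hom r'' s'') :
  x ** y ** z = hcast (addnA r r' r'') (addnA s s' s'') (x ** (y ** z)).
Proof.
rewrite -(cls_repr x) -(cls_repr y) -(cls_repr z) !hom_tensE -cls_cast.
exact/cls_eq/te_tensA.
Qed.

Lemma tensh0 r s (x : hom r s) :
  x ** idm 0 = hcast (esym (addn0 r)) (esym (addn0 s)) x.
Proof.
by rewrite -(cls_repr x) hom_tensE -cls_cast; apply/cls_eq/te_tensf0.
Qed.

Lemma tens_interchange r s r' s' (x : hom r s) (y : hom r' s') :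
  x ** idm s' @@ idm r ** y = idm s ** y @@ x ** idm r'.
Proof. by rewrite -!tens_comp !comph1 !comp1h. Qed.

(** * Strands added on the left and on the right *)

Definition lstrand r s (x : hom r s) : hom r.+1 s.+1 := idm 1 ** x.

Definition rstrand r s (x : hom r s) : hom r.+1 s.+1 :=
  hcast (addn1 r) (addn1 s) (x ** idm 1).

Lemma lstrand_comp r s t (x : hom s t) (y : hom r s) :
  lstrand (x @@ y) = lstrand x @@ lstrand y.
Proof. by rewrite {1}/lstrand -(comp1h (idm 1)) tens_comp. Qed.

Lemma lstrand_id r : lstrand (idm r) = idm r.+1.
Proof. by rewrite /lstrand tens_id. Qed.

Lemma lstrandD r s (x y : hom r s) : lstrand (x + y) = lstrand x + lstrand y.
Proof. by rewrite /lstrand tensDr. Qed.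

Lemma lstrandZ r s a (x : hom r s) : lstrand (a *: x) = a *: lstrand x.
Proof. by rewrite /lstrand tensZr. Qed.

Lemma rstrand_comp r s t (x : hom s t) (y : hom r s) :
  rstrand (x @@ y) = rstrand x @@ rstrand y.
Proof. by rewrite /rstrand -hcast_comp -tens_comp comp1h. Qed.

Lemma rstrand_id r : rstrand (idm r) = idm r.+1.
Proof. by rewrite /rstrand tens_id hcast_idm. Qed.

Lemma rstrandD r s (x y : hom r s) : rstrand (x + y) = rstrand x + rstrand y.
Proof. by rewrite /rstrand tensDl hcastD. Qed.

Lemma rstrandZ r s a (x : hom r s) : rstrand (a *: x) = a *: rstrand x.
Proof. by rewrite /rstrand tensZl hcastZ. Qed.

Lemma rstrand0 r s : rstrand (0 : hom r s) = 0.
Proof. by rewrite -(scale0r 0) rstrandZ scale0r. Qed.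

Lemma lstrand_hcast r r' s s' (er : r = r') (es : s = s') (x : hom r s) :
  lstrand (hcast er es x) = hcast (congr1 S er) (congr1 S es) (lstrand x).
Proof. by case: r' / er; case: s' / es. Qed.

Lemma rstrand_hcast r r' s s' (er : r = r') (es : s = s') (x : hom r s) :
  rstrand (hcast er es x) = hcast (congr1 S er) (congr1 S es) (rstrand x).
Proof. by case: r' / er; case: s' / es. Qed.

(** The strands added on the two sides do not interact; this is associativity of
    the tensor product. *)
Lemma rstrand_lstrand r s (x : hom r s) :
  rstrand (lstrand x) = lstrand (rstrand x).
Proof.
rewrite /rstrand lstrand_hcast /lstrand (tens_assoc (idm 1) x (idm 1)).
by rewrite hcast_hcast; apply: hcast_irr.
Qed.

Lemma lstrand_lstrand r s (x : hom r s) : lstrand (lstrand x) = idm 2 ** x.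
Proof.
by rewrite -[2%N]/(1 + 1)%N -tens_id (tens_assoc (idm 1)) hcast_id.
Qed.

Lemma rstrand_rstrand r s (x : hom r s) :
  rstrand (rstrand x) = hcast (addn2 r) (addn2 s) (x ** idm 2).
Proof.
rewrite {2}/rstrand rstrand_hcast /rstrand tens_assoc tens_id !hcast_hcast.
exact: hcast_irr.
Qed.

Lemma tens_id_eq r s (x : hom r s) k k' (e : k = k') :
  x ** idm k' = hcast (congr1 (addn r) e) (congr1 (addn s) e) (x ** idm k).
Proof. by case: k' / e. Qed.

Lemma rstrand_tens_id r s (x : hom r s) k :
  hcast (esym (addnS r k)) (esym (addnS s k)) (rstrand (x ** idm k)) =
  x ** idm k.+1.
Proof.
rewrite /rstrand tens_assoc tens_id !hcast_hcast (tens_id_eq x (addn1 k)).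
exact: hcast_irr.
Qed.

(** * Crossings at arbitrary positions *)

Local Notation crossing := (cls (@Cross R m)).
Local Notation cap := (cls (@Cap R m)).
Local Notation cup := (cls (@Cup R m)).

Definition scross n i : hom n n := cls (simple_cross R m n i).

Lemma scrossE n i j (e : (i + 2 + j)%N = n) :
  scross n i = hcast e e (idm i ** crossing ** idm j).
Proof.
rewrite /scross /simple_cross /hom_id !hom_tensE.
have ej : (n - (i + 2) = j)%N by rewrite -e addKn.
case: j / ej e => e; case: eqP => // e'.
by rewrite cls_cast; apply: hcast_irr.
Qed.

Lemma scross_default n i : (n <= i.+1)%N -> scross n i = idm n.
Proof.
move=> leni; rewrite /scross /simple_cross; case: eqP => // e; exfalso.
by move: e leni; lia.
Qed.

Lemma scross0 n : scross n.+2 0 = crossing ** idm n.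
Proof. by rewrite (scrossE (erefl : (0 + 2 + n)%N = n.+2)) /= tens0h. Qed.

Lemma scrossS n i : scross n.+1 i.+1 = lstrand (scross n i).
Proof.
have [leni|ltin] := leqP n i.+1; first by rewrite !scross_default // lstrand_id.
have e : (i + 2 + (n - (i + 2)))%N = n by lia.
rewrite (scrossE e) lstrand_hcast.
rewrite (scrossE (congr1 S e : (i.+1 + 2 + (n - (i + 2)))%N = n.+1)).
rewrite -[idm i.+1]/(idm (1 + i)%N) -tens_id (tens_assoc (idm 1)) hcast_id.
by rewrite (tens_assoc (idm 1) _ (idm _)) hcast_hcast; apply: hcast_irr.
Qed.

Lemma rstrand_scross n i : (i.+1 < n)%N -> rstrand (scross n i) = scross n.+1 i.
Proof.
elim: n i => // n IHn [|i] ltin; last first.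
  by rewrite !scrossS rstrand_lstrand IHn.
case: n ltin {IHn} => // n _.
by rewrite !scross0 -[RHS]rstrand_tens_id hcast_id.
Qed.

Lemma crossing_braid :
  crossing ** idm 1 @@ (idm 1 ** crossing @@ crossing ** idm 1) =
  idm 1 ** crossing @@ (crossing ** idm 1 @@ idm 1 ** crossing).
Proof.
have /cls_eq e := te_braid m delta.
by rewrite -!hom_compE -!hom_tensE -!(hom_tensE delta (Id 1)) in e; exact: e.
Qed.

Lemma scrossK n i : (i.+1 < n)%N -> scross n i @@ scross n i = idm n.
Proof.
elim: n i => // n IHn [|i] ltin; last first.
  by rewrite !scrossS -lstrand_comp IHn // lstrand_id.
case: n ltin {IHn} => // n _.
rewrite !scross0 -(tens_comp crossing crossing (idm n) (idm n)) comph1.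
have -> : crossing @@ crossing = idm 2.
  rewrite -[2%N]/(1 + 1)%N -tens_id /hom_id hom_tensE hom_compE.
  exact/cls_eq/te_crossK.
by rewrite tens_id.
Qed.

Lemma scross_far n i j : (i.+1 < j)%N -> (j.+1 < n)%N ->
  scross n i @@ scross n j = scross n j @@ scross n i.
Proof.
elim: n i j => // n IHn [|i] [//|j] ltij ltjn; last first.
  by rewrite !scrossS -!lstrand_comp IHn.
case: n j {IHn} ltjn ltij => [|n] [|j] // ltjn _.
rewrite scross0 !scrossS lstrand_lstrand.
exact: (tens_interchange crossing (scross n j)).
Qed.

Lemma scross_braid n i : (i.+2 < n)%N ->
  scross n i @@ scross n i.+1 @@ scross n i =
  scross n i.+1 @@ scross n i @@ scross n i.+1.
Proof.
elim: n i => // n IHn [|i] ltin.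
  case: n ltin {IHn} => [|[|n]] // _; rewrite scrossS !scross0.
  have -> : lstrand (crossing ** idm n) = idm 1 ** crossing ** idm n.
    by rewrite (tens_assoc (idm 1)) hcast_id.
  have -> : crossing ** idm n.+1 = crossing ** idm 1 ** idm n.
    by rewrite (tens_assoc crossing (idm 1)) tens_id hcast_id.
  set P := crossing ** idm 1; set Q := idm 1 ** crossing.
  have PQ := tens_comp P Q (idm n) (idm n).
  have QP := tens_comp Q P (idm n) (idm n).
  rewrite -!comp_assoc -PQ -QP -(tens_comp P (Q @@ P) (idm n) (idm n @@ idm n)).
  rewrite -(tens_comp Q (P @@ Q) (idm n) (idm n @@ idm n)).
  by rewrite crossing_braid.
by rewrite 2!(scrossS n) -!lstrand_comp IHn.
Qed.

(** * Caps, cups and the partial trace *)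

(** A cap (cup) on the last two of r + 2 strands.  Building it by adding strands
    on the left avoids transports along r + 2 and r + 0. *)
Fixpoint last_cap r : hom r.+2 r :=
  if r is q.+1 then lstrand (last_cap q) else cap.

Fixpoint last_cup r : hom r r.+2 :=
  if r is q.+1 then lstrand (last_cup q) else cup.

Lemma last_capE r : last_cap r = hcast (addn2 r) (addn0 r) (idm r ** cap).
Proof.
elim: r => [|r IHr]; first by rewrite tens0h hcast_id.
rewrite /= IHr lstrand_hcast -[idm r.+1]/(idm (1 + r)%N) -tens_id.
by rewrite (tens_assoc (idm 1)) hcast_hcast; apply: hcast_irr.
Qed.

Lemma last_cupE r : last_cup r = hcast (addn0 r) (addn2 r) (idm r ** cup).
Proof.
elim: r => [|r IHr]; first by rewrite tens0h hcast_id.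
rewrite /= IHr lstrand_hcast -[idm r.+1]/(idm (1 + r)%N) -tens_id.
by rewrite (tens_assoc (idm 1)) hcast_hcast; apply: hcast_irr.
Qed.

(** The interchange law: x and the cap act on disjoint sets of strands. *)
Lemma last_cap_natural r s (x : hom r s) :
  last_cap s @@ rstrand (rstrand x) = x @@ last_cap r.
Proof.
rewrite !last_capE rstrand_rstrand -hcast_comp -tens_interchange tensh0.
by rewrite (hcast_comp _ (addn0 r)) hcast_hcast hcast_id.
Qed.

Lemma last_cup_natural r s (x : hom r s) :
  rstrand (rstrand x) @@ last_cup r = last_cup s @@ x.
Proof.
rewrite !last_cupE rstrand_rstrand -hcast_comp tens_interchange tensh0.
by rewrite (hcast_comp _ (addn0 s)) hcast_hcast hcast_id.
Qed.

(** Closing the last strand: the right partial trace. *)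
Definition ptrace r (x : hom r.+1 r.+1) : hom r r :=
  last_cap r @@ rstrand x @@ last_cup r.

Lemma ptraceD r (x y : hom r.+1 r.+1) : ptrace (x + y) = ptrace x + ptrace y.
Proof. by rewrite /ptrace rstrandD compDr compDl. Qed.

Lemma ptraceZ r a (x : hom r.+1 r.+1) : ptrace (a *: x) = a *: ptrace x.
Proof. by rewrite /ptrace rstrandZ compZr compZl. Qed.

Lemma ptrace0 r : ptrace (0 : hom r.+1 r.+1) = 0.
Proof. by rewrite -(scale0r 0) ptraceZ scale0r. Qed.

Lemma ptrace_rstrandl r (x : hom r r) (y : hom r.+1 r.+1) :
  ptrace (rstrand x @@ y) = x @@ ptrace y.
Proof. by rewrite /ptrace rstrand_comp !comp_assoc last_cap_natural. Qed.

Lemma ptrace_rstrandr r (x : hom r r) (y : hom r.+1 r.+1) :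
  ptrace (y @@ rstrand x) = ptrace y @@ x.
Proof. by rewrite /ptrace rstrand_comp -!comp_assoc last_cup_natural. Qed.

Lemma ptrace_lstrand r (x : hom r.+1 r.+1) :
  ptrace (lstrand x) = lstrand (ptrace x).
Proof. by rewrite /ptrace rstrand_lstrand !lstrand_comp. Qed.

Lemma cap_cup : cap @@ cup = delta *: idm 0.
Proof.
rewrite hom_compE -[RHS]/(hom_scale _ _) hom_scaleE; exact/cls_eq/te_loop.
Qed.

Lemma zigzagl : cap ** idm 1 @@ idm 1 ** cup = idm 1.
Proof.
have /cls_eq e := te_zigzagl m delta.
by rewrite -!hom_compE -!hom_tensE -!(hom_tensE delta (Id 1)) in e; exact: e.
Qed.

Lemma zigzagr : idm 1 ** cap @@ cup ** idm 1 = idm 1.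
Proof.
have /cls_eq e := te_zigzagr m delta.
by rewrite -!hom_compE -!hom_tensE -!(hom_tensE delta Cup (Id 1)) in e; exact: e.
Qed.

Lemma crossing_cup : crossing @@ cup = cup.
Proof. rewrite hom_compE; exact/cls_eq/te_cross_cup. Qed.

Lemma cap_slide :
  cap ** idm 1 @@ idm 1 ** crossing = idm 1 ** cap @@ crossing ** idm 1.
Proof.
have /cls_eq e := te_cap_slide m delta.
rewrite -!hom_compE -!hom_tensE -!(hom_tensE delta (Id 1)) in e.
by rewrite -!(hom_tensE delta Cross (Id 1)) in e; exact: e.
Qed.

Lemma ptrace_id r : ptrace (idm r.+1) = delta *: idm r.
Proof.
elim: r => [|r IHr]; first by rewrite /ptrace rstrand_id comph1 cap_cup.
by rewrite -lstrand_id ptrace_lstrand IHr lstrandZ lstrand_id.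
Qed.

(** Closing a strand just after it crosses its neighbour straightens the
    neighbour: slide the cap through the crossing, absorb the crossing into the
    cup, and use the zigzag relation. *)
Lemma ptrace_last_cross r : ptrace (scross r.+2 r) = idm r.+1.
Proof.
elim: r => [|r IHr]; last by rewrite scrossS ptrace_lstrand IHr lstrand_id.
rewrite scross0 tensh0 hcast_id /ptrace /= /rstrand hcast_id /lstrand.
rewrite -cap_slide -comp_assoc -(tens_comp (idm 1) (idm 1) crossing cup).
by rewrite crossing_cup comp1h zigzagl.
Qed.

(** * Antisymmetrisers of the category *)

HB.instance Definition _ n := GRing.Zmodule_isPzRing.Build (Defs.hom m delta n n)
  (@comp_assoc n n n n) (@comp1h n n) (@comph1 n n)
  (@compDl n n n) (@compDr n n n).

Lemma mulhE n (x y : hom n n) : x * y = x @@ y. Proof. by []. Qed.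

(** This makes the results on coset sums and alternators available in the ring
    of endomorphisms of n strands. *)
Lemma scross_coxeter n : coxeter_relations (scross n) n.
Proof.
split=> [i|i|i j]; [exact: scrossK | exact: scross_braid | exact: scross_far].
Qed.

Lemma cls_word_term r w :
  cls (word_term R m r w) = \prod_(i <- rev w) scross r i.
Proof.
elim/last_ind: w => [|w i IHw]; first by rewrite big_nil.
by rewrite rev_rcons big_cons -IHw /word_term foldl_rcons -hom_compE.
Qed.

Lemma antisym_alternator r : antisym r = alternator (scross r) r.
Proof.
rewrite antisymE alternatorE; apply: eq_bigr => p _.
by rewrite scaler_sign mulr_sign cls_word_term.
Qed.

Lemma antisym_crossl r i : (i.+1 < r)%N ->
  scross r i @@ antisym r = - antisym r.
Proof.
rewrite antisym_alternator -mulhE => ltir.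
exact: (alternator_antisyml (@scross_coxeter r)).
Qed.

Lemma antisym_crossr r i : (i.+1 < r)%N ->
  antisym r @@ scross r i = - antisym r.
Proof.
rewrite antisym_alternator -mulhE => ltir.
exact: (alternator_antisymr (@scross_coxeter r)).
Qed.

Lemma rstrand_coset_sum n k : (k < n)%N ->
  rstrand (coset_sum (scross n) k) = coset_sum (scross n.+1) k.
Proof.
elim: k => [|k IHk] ltkn /=; first exact: rstrand_id.
rewrite -scaleN1r rstrandD rstrandZ mulhE rstrand_comp IHk ?(ltnW ltkn) //.
by rewrite rstrand_scross // [rstrand _]rstrand_id scaleN1r.
Qed.

Lemma rstrand_alternator n k : (k <= n)%N ->
  rstrand (alternator (scross n) k) = alternator (scross n.+1) k.
Proof.
elim: k => [|k IHk] ltkn /=; first exact: rstrand_id.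
by rewrite !mulhE rstrand_comp rstrand_coset_sum // IHk // ltnW.
Qed.

Lemma antisymS r :
  antisym r.+1 = coset_sum (scross r.+1) r @@ rstrand (antisym r).
Proof. by rewrite !antisym_alternator rstrand_alternator. Qed.

Lemma lstrand_alternator n k :
  lstrand (alternator (scross n) k) = alternator (fun i => scross n.+1 i.+1) k.
Proof.
have lcoset j :
    lstrand (coset_sum (scross n) j) = coset_sum (fun i => scross n.+1 i.+1) j.
  elim: j => [|j IHj] /=; first exact: lstrand_id.
  rewrite -scaleN1r lstrandD lstrandZ mulhE lstrand_comp IHj scrossS scaleN1r.
  by rewrite [lstrand _]lstrand_id.
elim: k => [|k IHk] /=; first exact: lstrand_id.
by rewrite !mulhE lstrand_comp lcoset IHk.
Qed.

Lemma antisym_absorbl r :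
  lstrand (antisym r) @@ antisym r.+1 = r`!%:R *: antisym r.+1.
Proof.
rewrite scaler_nat [antisym r]antisym_alternator lstrand_alternator.
by apply: mul_alternatorl => i ltir; apply: antisym_crossl.
Qed.

Lemma antisym_absorbr r :
  antisym r.+1 @@ lstrand (antisym r) = r`!%:R *: antisym r.+1.
Proof.
rewrite scaler_nat [antisym r]antisym_alternator lstrand_alternator.
by apply: mul_alternatorr => i ltir; apply: antisym_crossr.
Qed.

(** In the sum over cosets, the identity contributes delta; every other word
    ends in the last crossing, which the trace deletes, leaving minus a coset
    sum on one strand fewer, which acts on the antisymmetriser as r. *)
Lemma ptrace_antisym r : ptrace (antisym r.+1) = (delta - r%:R) *: antisym r.
Proof.
rewrite antisymS ptrace_rstrandr; case: r => [|r].
  by rewrite [ptrace _]ptrace_id compZl comp1h subr0.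
rewrite /= -[_ * _]/(_ @@ _) -rstrand_coset_sum // -scaleN1r ptraceD ptraceZ.
rewrite ptrace_rstrandl ptrace_last_cross comph1 [ptrace _]ptrace_id.
rewrite compDl !compZl comp1h scalerBl scaleN1r scaler_nat; congr (_ - _).
by apply: mul_coset_suml => i ltir; apply: antisym_crossl.
Qed.

(** S_n factors through S_r with n - r strands added. *)
Lemma antisym_eq0W a r n : (r <= n)%N ->
  a *: antisym r = 0 -> a *: antisym n = 0.
Proof.
move=> + ar0; elim: n => [|n IHn]; first by rewrite leqn0 => /eqP <-.
rewrite leq_eqVlt => /predU1P[<- // | /IHn an0].
by rewrite antisymS -compZr -rstrandZ an0 rstrand0 comp_zero.
Qed.

Lemma antisym1 : antisym 1 = idm 1.
Proof. by rewrite antisym_alternator /= !mulr1. Qed.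

Lemma antisym2_cup : antisym 2 @@ cup = 0.
Proof.
rewrite antisym_alternator /= !mulr1 mul1r -scaleN1r compDl compZl comp1h.
by rewrite scross0 tensh0 hcast_id crossing_cup scaleN1r subrr.
Qed.

(** Bending the second leg of the cup back turns it into a straight strand, so
    x can be read off from its composite with the cup. *)
Lemma bend_cup (x : hom 1 1) : last_cap 1 @@ rstrand (rstrand x @@ cup) = x.
Proof.
rewrite rstrand_comp comp_assoc last_cap_natural -comp_assoc /= /lstrand.
by rewrite /rstrand hcast_id zigzagr comph1.
Qed.

(** * The endomorphism kappa *)

Local Notation Dm := (cls (@Delta R m)).
Local Notation Ds := (cls (Star (@Delta R m))).

Lemma Delta_star : Dm @@ Ds = antisym m.
Proof. by rewrite hom_compE; apply/cls_eq/te_Delta. Qed.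

(** What remains of the antisymmetriser on m + 1 strands once Delta and its
    reflection close all strands but the first. *)
Definition kappa : hom 1 1 := lstrand Ds @@ antisym m.+1 @@ lstrand Dm.

Lemma kappa_tens_id r : rstrand (kappa ** idm r) = kappa ** idm r.+1.
Proof. by rewrite -[RHS]rstrand_tens_id hcast_id. Qed.

(** Writing both factors I x S_m in (I x S_m) S_(m+1) (I x S_m) as composites
    through Delta isolates kappa in the middle, and kappa slides past Delta by
    the interchange law. *)
Lemma antisym_kappa :
  kappa ** idm m @@ lstrand (antisym m) = (m`! * m`!)%:R *: antisym m.+1.
Proof.
rewrite -Delta_star lstrand_comp.
have Dk : lstrand Dm @@ kappa = kappa ** idm m @@ lstrand Dm.
  by rewrite /lstrand (tens_interchange kappa Dm) tensh0 hcast_id.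
rewrite comp_assoc -Dk /kappa !comp_assoc -lstrand_comp Delta_star -2!comp_assoc.
rewrite -comp_assoc -lstrand_comp Delta_star antisym_absorbr compZr.
by rewrite antisym_absorbl scalerA natrM.
Qed.

(** Descending induction on r: closing the last strand turns S_r into
    (delta - (r - 1)) S_(r-1) on the left and S_(r+1) into (delta - r) S_r on
    the right. *)
Lemma antisym_kappa_trace r : (r <= m)%N ->
  (\prod_(r <= i < m) (delta - i%:R)) *: (kappa ** idm r @@ lstrand (antisym r)) =
  ((m`! * m`!)%:R * \prod_(r <= i < m) (delta - i.+1%:R)) *: antisym r.+1.
Proof.
move=> lerm; rewrite -(subKn lerm).
elim: (m - r)%N (leq_subr r m) => [|j IHj] ltjm.
  by rewrite subn0 !big_geq // scale1r mulr1 antisym_kappa.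
have ltm : (m - j.+1 < m)%N by lia.
have eS : (m - j = (m - j.+1).+1)%N by lia.
have {IHj} := IHj (ltnW ltjm); rewrite eS; set q := (m - j.+1)%N in ltm *.
move=> /(congr1 (@ptrace q.+1)).
rewrite !ptraceZ -kappa_tens_id ptrace_rstrandl ptrace_lstrand !ptrace_antisym.
rewrite lstrandZ compZr !scalerA !(big_ltn ltm) => e.
by rewrite [X in X *: _]mulrC e mulrCA mulrC mulrA.
Qed.

End Category.

(** * The value of delta *)

Theorem theorem5p5 (R : idomainType) (m : nat) (delta : R)
  (m_ge2 : (2 <= m)%N)
  (fact_neq0 : (m`!)%:R != 0 :> R)
  (tf_m : hom_torsion_free m delta m m)
  (tf_m1 : hom_torsion_free m delta (m + 1) (m + 1))
  (Sigma_neq0 : antisym m delta m <> 0) :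
  [/\ antisym m delta (m + 1) =
        (f_poly R m).[delta] *: hom_tens (antisym m delta m) (hom_id m delta 1),
      antisym m delta (m + 1) = 0
    & delta = m%:R].
Proof.
have nat_neq0 k : (0 < k <= m)%N -> k%:R != 0 :> R.
  move=> /andP[k_gt0 lekm]; apply: contraNneq fact_neq0 => k0.
  have /dvdnP[q ->] : (k %| m`!)%N by apply: dvdn_fact; rewrite k_gt0.
  by rewrite natrM k0 mulr0.
have Sm_tf a : a *: antisym m delta m = 0 -> a = 0 by move/tf_m; case.
(* Otherwise a_q = 0 in [antisym_kappa_trace], whereas b_q is nonzero. *)
have delta_neq q : (0 < q < m)%N -> delta != q%:R.
  move=> /andP[q_gt0 ltqm]; apply/eqP => eq_delta.
  have := @antisym_kappa_trace R m delta q (ltnW ltqm).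
  rewrite (big_ltn ltqm) (_ : delta - q%:R = 0); last by rewrite eq_delta subrr.
  rewrite mul0r scale0r => /esym.
  move=> /(@antisym_eq0W _ _ _ _ _ m ltqm)/Sm_tf/eqP.
  rewrite natrM !mulf_eq0 (negPf fact_neq0) /= => /eqP.
  apply/eqP; rewrite prodf_seq_neq0.
  apply/allP => i; rewrite mem_index_iota => /andP[leqi ltim] /=.
  rewrite eq_delta -opprB oppr_eq0 -natrB ?leqW //; apply: nat_neq0.
  by lia.
set a := \prod_(1 <= i < m) (delta - i%:R).
have a_neq0 : a != 0.
  rewrite prodf_seq_neq0; apply/allP => i.
  rewrite mem_index_iota => /delta_neq /=.
  by rewrite subr_eq0.
(* The case r = 1 of [antisym_kappa_trace], composed with the cup. *)
have kappa0 : a *: kappa m delta = 0.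
  have := @antisym_kappa_trace R m delta 1 (ltnW m_ge2); rewrite -/a antisym1.
  move=> /(congr1 (fun x => hom_comp x (cls delta Cup))).
  rewrite lstrand_id comph1 !compZl antisym2_cup scaler0.
  have -> : hom_tens (kappa m delta) (hom_id m delta 1) =
      rstrand (kappa m delta).
    by rewrite /rstrand hcast_id.
  rewrite -compZl -rstrandZ => e.
  by rewrite -[LHS]bend_cup e rstrand0 comp_zero.
have antisym0 : antisym m delta m.+1 = 0.
  rewrite -[m.+1]addn1.
  have e : (a * (m`! * m`!)%:R) *: antisym m delta (m + 1) = 0.
    rewrite -scalerA addn1 -antisym_kappa -compZl -(tensZl a (kappa m delta)).
    by rewrite kappa0 zero_tens zero_comp.
  case: (tf_m1 _ _ e) => [/eqP|//].
  by rewrite natrM !mulf_eq0 (negPf fact_neq0) (negPf a_neq0).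
have delta_eq : delta = m%:R.
  apply/eqP; rewrite -subr_eq0; apply/eqP/Sm_tf; rewrite -ptrace_antisym.
  by rewrite antisym0 ptrace0.
have antisymD1 : antisym m delta (m + 1) = 0 by rewrite addn1.
split=> //; rewrite antisymD1.
suff -> : (f_poly R m).[delta] = 0 by rewrite scale0r.
rewrite /f_poly hornerD hornerN hornerC horner_prod delta_eq.
apply/eqP; rewrite subr_eq0 fact_prod natr_prod; apply/eqP.
rewrite big_nat_rev /= [in RHS](_ : m.-1.+1 = m) ?prednK ?(ltnW m_ge2) //.
apply: eq_big_nat => i /andP[i_gt0 ltim]; rewrite hornerXsubC.
by rewrite -natrB; [congr _%:R; lia | lia].
Qed.
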